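(* Let $k$ be a local field and let $\mathcal{A}$ be a Banach $k$-algebra such that $\{\|a\| : a \in \mathcal{A}\} = \{|c| : c \in k\}$. If $\overline{\mathcal{A}}$ is a finite dimensional simple $\bar k$-algebra, then the underlying $k$-algebra of $\mathcal{A}$ is a finite dimensional simple $k$-algebra.
   Context: A local field is a complete discrete valuation field $k$ with finite residue field $\bar k$, equipped with a fixed non-Archimedean absolute value $|\cdot|$. Rings are associative and unital. A Banach $k$-algebra is a $k$-algebra $\mathcal{A}$ with a non-Archimedean norm $\|\cdot\|$ making it a complete normed $k$-vector space, with $\|ab\| \le \|a\|\,\|b\|$, $\|1\| \in \{0,1\}$, and $\|ca\| = |c|\,\|a\|$ for $c \in k$. Put $\mathcal{A}(1) = \{a : \|a\| \le 1\}$, $\mathcal{A}(1-) = \{a : \|a\| < 1\}$, and the reduction $\overline{\mathcal{A}} = \mathcal{A}(1)/\mathcal{A}(1-)$, a $\bar k$-algebra. A simple ring is a ring with no two-sided ideals other than $0$ and itself; a simple algebra is an algebra whose underlying ring is simple. *)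

(* Defs.v *)
From HB Require Import structures.
From mathcomp Require Import all_boot all_order all_algebra.
From mathcomp Require Import generic_quotient ring_quotient.
From mathcomp Require Import all_classical all_reals.

Set Implicit Arguments.
Unset Strict Implicit.
Unset Printing Implicit Defensive.

Import Order.TTheory GRing.Theory Num.Theory.

Local Open Scope classical_set_scope.
Local Open Scope ring_scope.

(* Rings with a submultiplicative non-Archimedean norm. This is the common part
   of local fields and Banach algebras, and all that is needed to form the
   reduction. Only nonzero rings are considered, so [unorm 1 = 1] below. *)
HB.mixin Record isUltraNormed (R : realType) A of GRing.NzRing A := {
  unorm : A -> R;
  unorm_ge0 : forall x : A, 0 <= unorm x;
  unorm_eq0 : forall x : A, unorm x = 0 <-> x = 0;
  unormB : forall x y : A, unorm (x - y) <= Num.max (unorm x) (unorm y);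
  unormM : forall x y : A, unorm (x * y) <= unorm x * unorm y;
  unorm1 : unorm 1 = 0 \/ unorm 1 = 1
}.

#[short(type="ultraNormedRingType")]
HB.structure Definition UltraNormedRing (R : realType) :=
  {A of GRing.NzRing A & isUltraNormed R A}.

Section Complete.
Variables (R : realType) (A : ultraNormedRingType R).

Definition ucauchy (u : nat -> A) : Prop :=
  forall e : R, 0 < e -> exists N : nat, forall m n : nat,
    (N <= m)%N -> (N <= n)%N -> unorm (u m - u n) < e.

Definition uconverges (u : nat -> A) (l : A) : Prop :=
  forall e : R, 0 < e -> exists N : nat, forall n : nat,
    (N <= n)%N -> unorm (u n - l) < e.

Definition ucomplete : Prop :=
  forall u : nat -> A, ucauchy u -> exists l : A, uconverges u l.

End Complete.

Section UltraNormTheory.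
Variables (R : realType) (A : ultraNormedRingType R).
Implicit Types x y : A.

Lemma unorm0 : unorm (0 : A) = 0.
Proof. exact/unorm_eq0. Qed.

Lemma unorm11 : unorm (1 : A) = 1.
Proof.
by case: (@unorm1 R A) => // /unorm_eq0/eqP; rewrite oner_eq0.
Qed.

Lemma unormN x : unorm (- x) = unorm x.
Proof.
suff le y : unorm (- y) <= unorm y.
  by apply/le_anti; rewrite le /= -{1}[x]opprK le.
by rewrite -sub0r (le_trans (unormB _ _))// unorm0 ge_max unorm_ge0 lexx.
Qed.

Lemma unormD x y : unorm (x + y) <= Num.max (unorm x) (unorm y).
Proof. by rewrite -{1}[y]opprK (le_trans (unormB _ _))// unormN. Qed.

End UltraNormTheory.

Definition closed_ball (R : realType) (A : ultraNormedRingType R) : {pred A} :=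
  fun x => unorm x <= 1.
Arguments closed_ball {R} A.

(* The subring A(1). *)
Record unit_ball (R : realType) (A : ultraNormedRingType R) := UnitBall {
  ball_val :> A;
  _ : closed_ball A ball_val
}.
Arguments unit_ball {R} A.

Section UnitBall.
Variables (R : realType) (A : ultraNormedRingType R).

Fact closed_ball_subring : subring_closed (closed_ball A).
Proof.
split=> [|x y xA yA|x y xA yA]; rewrite unfold_in /closed_ball.
- by rewrite unorm11.
- by rewrite (le_trans (unormB _ _))// ge_max; apply/andP.
- by rewrite (le_trans (unormM _ _))// mulr_ile1// unorm_ge0.
Qed.

HB.instance Definition _ :=
  GRing.isSubringClosed.Build A (closed_ball A) closed_ball_subring.

HB.instance Definition _ := [isSub for @ball_val R A].
HB.instance Definition _ := [Choice of unit_ball A by <:].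
HB.instance Definition _ := [SubChoice_isSubNzRing of unit_ball A by <:].

(* A(1-), as a subset of A(1). *)
Definition open_ball : {pred unit_ball A} := fun x => unorm (ball_val x) < 1.

Fact open_ball_zmod : zmod_closed open_ball.
Proof.
split=> [|x y xA yA]; rewrite unfold_in /open_ball /=.
  by rewrite unorm0.
by rewrite (le_lt_trans (unormB _ _))// gt_max; apply/andP.
Qed.

HB.instance Definition _ :=
  GRing.isZmodClosed.Build (unit_ball A) open_ball open_ball_zmod.

Lemma open_ballMl (a x : unit_ball A) : x \in open_ball -> a * x \in open_ball.
Proof.
rewrite !unfold_in /open_ball /= => x1; rewrite (le_lt_trans (unormM _ _))//.
by rewrite (le_lt_trans _ x1)// ler_piMl ?unorm_ge0//; case: a.
Qed.

Lemma open_ballMr (a x : unit_ball A) : x \in open_ball -> x * a \in open_ball.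
Proof.
rewrite !unfold_in /open_ball /= => x1; rewrite (le_lt_trans (unormM _ _))//.
by rewrite (le_lt_trans _ x1)// ler_piMr ?unorm_ge0//; case: a.
Qed.

End UnitBall.
Arguments open_ball {R} A.

Definition reduction (R : realType) (A : ultraNormedRingType R) : Type :=
  {ideal_quot open_ball A}.
Arguments reduction {R} A.

Local Open Scope quotient_scope.

Section Reduction.
Variables (R : realType) (A : ultraNormedRingType R).
Implicit Types (x y z : reduction A) (a b : unit_ball A).

HB.instance Definition _ := GRing.Zmodule.on (reduction A).

Definition red (a : unit_ball A) : reduction A := \pi_({ideal_quot open_ball A}) a.

Definition lift_red x : unit_ball A := repr (x : {ideal_quot open_ball A}).

Lemma lift_redK x : red (lift_red x) = x.
Proof. exact: reprK. Qed.

Lemma eq_red a b : (red a = red b) <-> (unorm (ball_val a - ball_val b) < 1).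
Proof.
by split=> [/eqP|ab]; last apply/eqP; rewrite /red -Quotient.idealrBE.
Qed.

Lemma redP a b : reflect (red a = red b) (a - b \in open_ball A).
Proof. by rewrite Quotient.idealrBE; exact: eqP. Qed.

Lemma red0 : red 0 = 0. Proof. by rewrite /red !piE. Qed.
Lemma redD a b : red (a + b) = red a + red b.
Proof. exact: (raddfD \pi_({ideal_quot open_ball A})). Qed.

Definition red_one : reduction A := red 1.
(* [a] * [b] = [a * b], see [red_mulE]. *)
Definition red_mul x y : reduction A := red (lift_red x * lift_red y).

Lemma red_mulE a b : red_mul (red a) (red b) = red (a * b).
Proof.
apply/redP; set a' := lift_red _; set b' := lift_red _.
have -> : a' * b' - a * b = a' * (b' - b) + (a' - a) * b.
  by rewrite mulrBr mulrBl addrA subrK.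
by apply: rpredD; [apply: open_ballMl|apply: open_ballMr]; apply/redP;
  rewrite lift_redK.
Qed.

Fact red_mulA : associative red_mul.
Proof.
move=> x y z; rewrite -[x]lift_redK -[y]lift_redK -[z]lift_redK.
by rewrite !red_mulE mulrA.
Qed.

Fact red_mul1l : left_id red_one red_mul.
Proof. by move=> x; rewrite -[x]lift_redK red_mulE mul1r. Qed.

Fact red_mul1r : right_id red_one red_mul.
Proof. by move=> x; rewrite -[x]lift_redK red_mulE mulr1. Qed.

Fact red_mulDl : left_distributive red_mul +%R.
Proof.
move=> x y z; rewrite -[x]lift_redK -[y]lift_redK -[z]lift_redK.
by rewrite -redD !red_mulE -redD mulrDl.
Qed.

Fact red_mulDr : right_distributive red_mul +%R.
Proof.
move=> x y z; rewrite -[x]lift_redK -[y]lift_redK -[z]lift_redK.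
by rewrite -redD !red_mulE -redD mulrDr.
Qed.

Fact red_one_neq0 : red_one != 0.
Proof.
rewrite -red0; apply/eqP/redP.
by rewrite subr0 unfold_in /open_ball /= unorm11 ltxx.
Qed.

HB.instance Definition _ := GRing.Zmodule_isNzRing.Build (reduction A)
  red_mulA red_mul1l red_mul1r red_mulDl red_mulDr red_one_neq0.

Lemma red1 : red 1 = 1. Proof. by []. Qed.
Lemma redM a b : red (a * b) = red a * red b.
Proof. by rewrite -red_mulE. Qed.

End Reduction.
Arguments red {R A}.

(* [unorm] is the absolute value; [abs_discrete] says that the value group is
   infinite cyclic, generated by the absolute value of a uniformizer. *)
HB.mixin Record isLocalField (R : realType) k
    of GRing.Field k & UltraNormedRing R k := {
  absM : forall x y : k, unorm (x * y) = unorm x * unorm y :> R;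
  abs_discrete : exists pi : k, [/\ 0 < unorm pi :> R, unorm pi < 1 :> R &
    forall x : k, x != 0 -> exists n : int, unorm x = (unorm pi : R) ^ n];
  abs_complete : ucomplete k;
  residue_finite : finite_set [set: reduction k]
}.

#[short(type="localFieldType")]
HB.structure Definition LocalField (R : realType) :=
  {k of GRing.Field k & UltraNormedRing R k & isLocalField R k}.

Definition residue_field (R : realType) (k : localFieldType R) : Type :=
  reduction k.
Arguments residue_field {R} k.

Section ResidueField.
Variables (R : realType) (k : localFieldType R).
Implicit Types x y : residue_field k.

HB.instance Definition _ := GRing.NzRing.on (residue_field k).

Fact residue_mulC : commutative ( *%R : residue_field k -> _ -> _).
Proof.
move=> x y; rewrite -[x]lift_redK -[y]lift_redK -!redM; congr red.
by apply: val_inj; exact: mulrC.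
Qed.

HB.instance Definition _ :=
  GRing.PzRing_hasCommutativeMul.Build (residue_field k) residue_mulC.

Lemma absV (c : k) : unorm c^-1 = (unorm c)^-1 :> R.
Proof.
have [->|c0] := eqVneq c 0; first by rewrite invr0 unorm0 invr0.
have nc0 : unorm c != 0 :> R by apply/eqP => /unorm_eq0/eqP; apply/negP.
by apply: (mulfI nc0); rewrite -absM !divff// unorm11.
Qed.

Definition ball_inv (c : unit_ball k) : unit_ball k :=
  insubd (0 : unit_ball k) (ball_val c)^-1.

Definition residue_inv x : residue_field k :=
  if x == 0 then 0 else red (ball_inv (lift_red x)).

Fact residue_mulV x : x != 0 -> residue_inv x * x = 1.
Proof.
move=> x0; rewrite /residue_inv (negbTE x0) -{2}[x]lift_redK -redM -red1.
set c := lift_red x.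
have c1 : unorm (ball_val c) = 1 :> R.
  apply/eqP; rewrite eq_le; apply/andP; split; first by case: (c).
  rewrite leNgt; apply/negP => c1; move/negP: x0; apply; apply/eqP.
  rewrite -[x]lift_redK -(red0 k); apply/eq_red.
  by rewrite /= subr0.
congr red; apply: val_inj => /=.
rewrite /ball_inv val_insubd /closed_ball absV c1 invr1 lexx mulVf//.
by apply/eqP => /unorm_eq0; apply/eqP; rewrite c1 oner_eq0.
Qed.

Fact residue_inv0 : residue_inv 0 = 0.
Proof. by rewrite /residue_inv eqxx. Qed.

HB.instance Definition _ := GRing.ComNzRing_isField.Build (residue_field k)
  residue_mulV residue_inv0.

End ResidueField.

HB.mixin Record isBanachAlgebra (R : realType) (k : localFieldType R) A
    of GRing.Algebra k A & UltraNormedRing R A := {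
  unormZ : forall (c : k) (a : A), unorm (c *: a) = unorm c * unorm a :> R;
  banach_complete : ucomplete A
}.

#[short(type="banachAlgType")]
HB.structure Definition BanachAlgebra (R : realType) (k : localFieldType R) :=
  {A of GRing.Algebra k A & UltraNormedRing R A & isBanachAlgebra R k A}.

Section ReductionAlgebra.
Variables (R : realType) (k : localFieldType R) (A : banachAlgType k).
Implicit Types (x y : reduction A) (c d : residue_field k).

Fact ball_scale_subproof (c : unit_ball k) (a : unit_ball A) :
  closed_ball A (ball_val c *: ball_val a).
Proof.
by rewrite /closed_ball unormZ mulr_ile1 ?unorm_ge0//; [case: c|case: a].
Qed.

Definition ball_scale (c : unit_ball k) (a : unit_ball A) : unit_ball A :=
  UnitBall (ball_scale_subproof c a).

(* [c] *: [a] = [c *: a], see [red_scaleE]. *)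
Definition red_scale c x : reduction A :=
  red (ball_scale (lift_red c) (lift_red x)).

Lemma red_scaleE (c : unit_ball k) (a : unit_ball A) :
  red_scale (red c) (red a) = red (ball_scale c a).
Proof.
apply/eq_red => /=.
have /eq_red := lift_redK (red c); have /eq_red := lift_redK (red a).
set c' := lift_red (red c); set a' := lift_red (red a) => a'a c'c.
have -> : ball_val c' *: ball_val a' - ball_val c *: ball_val a =
    ball_val c' *: (ball_val a' - ball_val a) +
    (ball_val c' - ball_val c) *: ball_val a.
  by rewrite scalerBr scalerBl addrA subrK.
rewrite (le_lt_trans (unormD _ _))// gt_max !unormZ; apply/andP; split.
  by rewrite (le_lt_trans _ a'a)// ler_piMl ?unorm_ge0//; case: (c').
by rewrite (le_lt_trans _ c'c)// ler_piMr ?unorm_ge0//; case: (a).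
Qed.

Fact red_scaleA c d x : red_scale c (red_scale d x) = red_scale (c * d) x.
Proof.
rewrite -[c]lift_redK -[d]lift_redK -[x]lift_redK -redM !red_scaleE.
by congr red; apply: val_inj; exact: scalerA.
Qed.

Fact red_scale1 : left_id 1 red_scale.
Proof.
move=> x; rewrite -[x]lift_redK -red1 red_scaleE.
by congr red; apply: val_inj; exact: scale1r.
Qed.

Fact red_scaleDr : right_distributive red_scale +%R.
Proof.
move=> c x y; rewrite -[c]lift_redK -[x]lift_redK -[y]lift_redK -redD.
rewrite !red_scaleE -redD.
by congr red; apply: val_inj; exact: scalerDr.
Qed.

Fact red_scaleDl x : {morph red_scale^~ x : c d / c + d}.
Proof.
move=> c d; rewrite -[c]lift_redK -[x]lift_redK -[d]lift_redK -redD.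
rewrite !red_scaleE -redD.
by congr red; apply: val_inj; exact: scalerDl.
Qed.

HB.instance Definition _ := GRing.Zmodule_isLmodule.Build (residue_field k)
  (reduction A) red_scaleA red_scale1 red_scaleDr red_scaleDl.

Fact red_scaleAl c x y : c *: (x * y) = (c *: x) * y.
Proof.
rewrite -[c]lift_redK -[x]lift_redK -[y]lift_redK -redM.
rewrite [LHS]red_scaleE [X in _ = X * _]red_scaleE -redM.
by congr red; apply: val_inj; exact: scalerAl.
Qed.

HB.instance Definition _ := GRing.Lmodule_isLalgebra.Build (residue_field k)
  (reduction A) red_scaleAl.

Fact red_scaleAr c x y : c *: (x * y) = x * (c *: y).
Proof.
rewrite -[c]lift_redK -[x]lift_redK -[y]lift_redK -redM.
rewrite [LHS]red_scaleE [X in _ = _ * X]red_scaleE -redM.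
by congr red; apply: val_inj; exact: scalerAr.
Qed.

HB.instance Definition _ := GRing.Lalgebra_isAlgebra.Build (residue_field k)
  (reduction A) red_scaleAr.

End ReductionAlgebra.

Definition two_sided_ideal (A : nzRingType) (I : set A) : Prop :=
  [/\ I 0, forall x y, I x -> I y -> I (x + y),
      forall a x, I x -> I (a * x) & forall a x, I x -> I (x * a)].

Definition simple_ring (A : nzRingType) : Prop :=
  forall I : set A, two_sided_ideal I -> I = [set 0] \/ I = [set: A].

(* [V] is linearly isomorphic to a space of row vectors. *)
Definition finite_dimensional (F : fieldType) (V : lmodType F) : Prop :=
  exists n : nat, inhabited (Vector.axiom n V).

Definition fin_dim_simple_algebra (F : fieldType) (A : algType F) : Prop :=
  finite_dimensional A /\ simple_ring A.

(* Main.v *)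
From HB Require Import structures.
From mathcomp Require Import all_boot all_order all_algebra.
From mathcomp Require Import all_classical all_reals.
From mathcomp Require Import topology normedtype sequences.
Require Import Defs.

Set Implicit Arguments.
Unset Strict Implicit.
Unset Printing Implicit Defensive.

Import Order.TTheory GRing.Theory Num.Theory.
Import numFieldNormedType.Exports.

Local Open Scope classical_set_scope.
Local Open Scope ring_scope.

(** Lift a basis of the reduction to elements [f i] of the unit ball. They are
    free over [k]: rescale a relation so that its largest coefficient is [1]
    and reduce it. They span: since the norms of [A] are values of [k], an
    element of norm [< 1] is [pi] times an element of the unit ball, so every
    element of the unit ball has an expansion in powers of [pi], whose
    coefficients converge by completeness of [k]. This works for every choice
    of lifts. A nonzero two-sided ideal [I] meets the unit sphere, so by
    simplicity its reduction is everything, the lifts can be taken inside [I],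
    and their span is contained in [I]. *)

(** * Geometric decay and bases *)

Lemma expr_lt_eps (R : realType) (q e : R) : 0 <= q -> q < 1 -> 0 < e ->
  exists N : nat, q ^+ N < e.
Proof.
move=> q0 q1 e0.
have /cvgrPdist_lt/(_ _ e0)[N _ /(_ _ (leqnn N))] : (GRing.exp q) @ \oo --> (0 : R).
  by apply: cvg_expr; rewrite ger0_norm.
by rewrite sub0r normrN ger0_norm ?exprn_ge0//; exists N.
Qed.

(** Pulling the standard row vectors back along the coordinate isomorphism gives a family whose
    members can be lifted one by one. *)
Lemma finite_dimensional_basis (F : fieldType) (V : lmodType F) :
  finite_dimensional V -> exists (n : nat) (e : 'I_n -> V),
    (forall c : 'I_n -> F, \sum_i c i *: e i = 0 -> forall i, c i = 0) /\
    (forall x, exists c : 'I_n -> F, x = \sum_i c i *: e i).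
Proof.
move=> [n [[v2r v2r_lin [r2v v2rK r2vK]]]].
pose phi : {linear V -> 'rV[F]_n} :=
  HB.pack v2r (GRing.isLinear.Build _ _ _ _ v2r v2r_lin).
exists n, (fun i => r2v (delta_mx 0 i)).
have phi_comb (c : 'I_n -> F) :
    phi (\sum_i c i *: r2v (delta_mx 0 i)) = \row_i c i.
  rewrite linear_sum [RHS]row_sum_delta; apply: eq_bigr => i _.
  by rewrite linearZ /= r2vK mxE.
split=> [c /(congr1 phi)|x].
  by rewrite phi_comb linear0 => /rowP c0 i; have := c0 i; rewrite !mxE.
exists (phi x 0); apply: (can_inj v2rK); rewrite -[RHS]/(phi _) phi_comb.
by apply/rowP => i; rewrite mxE.
Qed.

(** * Ultrametric estimates *)

Section UltraNorm.
Variables (R : realType) (A : ultraNormedRingType R).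

Lemma unorm_gt0 (x : A) : (0 < unorm x) = (x != 0).
Proof.
rewrite lt_def unorm_ge0 andbT; congr (~~ _).
by apply/eqP/eqP => /unorm_eq0.
Qed.

Lemma unorm_sum_le (I : finType) (F : I -> A) (e : R) : 0 <= e ->
  (forall i, unorm (F i) <= e) -> unorm (\sum_i F i) <= e.
Proof.
move=> e0 Fe; elim/big_ind: _ => [|x y xe ye|//]; first by rewrite unorm0.
by rewrite (le_trans (unormD _ _))// ge_max xe.
Qed.

(** The ultrametric inequality bounds the telescoping sum by its largest term, so no factor
    [1 / (1 - q)] appears. *)
Lemma unorm_geometric_le (u : nat -> A) (q : R) : 0 <= q -> q <= 1 ->
  (forall m, unorm (u m.+1 - u m) <= q ^+ m) ->
  forall N m, (N <= m)%N -> unorm (u m - u N) <= q ^+ N.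
Proof.
move=> q0 q1 uq N m /subnK <-; elim: (m - N)%N => [|p IH].
  by rewrite add0n subrr unorm0 exprn_ge0.
rewrite addSn -(subrK (u (p + N)%N) (u _.+1)) -addrA.
rewrite (le_trans (unormD _ _))// ge_max IH andbT (le_trans (uq _))//.
by rewrite exprD ler_piMl ?exprn_ge0 ?exprn_ile1.
Qed.

Lemma geometric_ucauchy (u : nat -> A) (q : R) : 0 <= q -> q < 1 ->
  (forall m, unorm (u m.+1 - u m) <= q ^+ m) -> ucauchy u.
Proof.
move=> q0 q1 uq e e0; have [N Ne] := expr_lt_eps q0 q1 e0.
have uN m : (N <= m)%N -> unorm (u m - u N) < e.
  by move=> /(unorm_geometric_le q0 (ltW q1) uq)/le_lt_trans; exact.
exists N => m n /uN mN /uN nN.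
have -> : u m - u n = (u m - u N) - (u n - u N).
  by rewrite opprB addrA subrK.
by rewrite (le_lt_trans (unormB _ _))// gt_max mN.
Qed.

Lemma red_sum (I : finType) (F : I -> unit_ball A) :
  red (\sum_i F i) = \sum_i red (F i).
Proof. exact: (big_morph _ (@redD R A) (@red0 R A)). Qed.

Lemma val_ball_sum (I : finType) (F : I -> unit_ball A) :
  ball_val (\sum_i F i) = \sum_i ball_val (F i).
Proof. exact: (raddf_sum (val : unit_ball A -> A)). Qed.

End UltraNorm.

(** * The value group of a local field *)

Section LocalField.
Variables (R : realType) (k : localFieldType R).

(** A nonzero value is a power of [unorm pi], and being below 1 forces a positive exponent. *)
Lemma uniformizer : exists pi : k, [/\ 0 < unorm pi :> R, unorm pi < 1 :> R &
  forall x : k, unorm x < 1 :> R -> unorm x <= unorm pi :> R].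
Proof.
have [pi [pi0 pi1 pin]] := @abs_discrete R k; exists pi; split=> // x x1.
have [->|x0] := eqVneq x 0; first by rewrite unorm0 ltW.
have [[n|n] xn] := pin x x0.
  case: n xn => [|n] xn; first by rewrite xn expr0z ltxx in x1.
  by rewrite xn -exprnP exprS ler_piMr ?(ltW pi0)// exprn_ile1 ?(ltW pi0)// ltW.
move: x1; rewrite xn NegzE -exprnN ltNge => /negP[].
by rewrite invf_ge1 ?exprn_gt0// exprn_ile1// ltW.
Qed.

End LocalField.

(** * Linear combinations of lifts *)

Section Banach.
Variables (R : realType) (k : localFieldType R) (A : banachAlgType k).
Hypothesis hval : range (@unorm R A) = range (@unorm R k).

Lemma scale_redE (c : unit_ball k) (a : unit_ball A) :
  (red c : residue_field k) *: red a = red (ball_scale c a).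
Proof. exact: red_scaleE. Qed.

Lemma unorm_in_value_group (a : A) : exists c : k, unorm a = unorm c :> R.
Proof.
have : range (@unorm R k) (unorm a) by rewrite -hval; exists a.
by move=> [c _ <-]; exists c.
Qed.

Section Lift.
Variables (n : nat) (f : 'I_n -> unit_ball A).

Definition comb (v : 'rV[k]_n) : A := \sum_i v 0 i *: ball_val (f i).

Lemma comb_linear : linear comb.
Proof.
move=> c u v; rewrite /comb scaler_sumr -big_split; apply: eq_bigr => i _ /=.
by rewrite !mxE scalerDl scalerA.
Qed.

HB.instance Definition _ :=
  GRing.isLinear.Build k 'rV[k]_n A *:%R comb comb_linear.

(** This carries relations with coefficients in the unit ball over to the residue field. *)
Lemma red_comb (c : 'I_n -> unit_ball k) (a : unit_ball A) :
  ball_val a = comb (\row_i ball_val (c i)) ->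
  red a = \sum_i (red (c i) : residue_field k) *: red (f i).
Proof.
move=> aE; under eq_bigr do rewrite scale_redE; rewrite -red_sum; congr red.
apply: val_inj; rewrite /= aE val_ball_sum.
by apply: eq_bigr => i _; rewrite mxE.
Qed.

Lemma comb_free :
  (forall c : 'I_n -> residue_field k,
     \sum_i c i *: red (f i) = 0 -> forall i, c i = 0) ->
  injective comb.
Proof.
move=> free; apply: raddf_inj => v v0; apply/eqP/negPn/negP => /eqP vn0.
have [j vj] : exists j, v 0 j != 0.
  apply: contrapT => /forallNP all0; apply: vn0; apply/rowP => j.
  by rewrite mxE; apply/eqP/negPn/negP; exact: all0.
(* Dividing by a coefficient of largest norm puts all coefficients in the unit ball and makes the
   [i0]-th equal to 1. *)
have [i0 _ max0] := @arg_maxP _ _ _ j xpredT (fun i => unorm (v 0 i) : R) isT.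
have vi0 : v 0 i0 != 0.
  by rewrite -(unorm_gt0 (v 0 i0)) (lt_le_trans _ (max0 j isT))//
     (unorm_gt0 (v 0 j)).
have w1 i : closed_ball k ((v 0 i0)^-1 * v 0 i).
  by rewrite /closed_ball absM absV mulrC ler_pdivrMr ?unorm_gt0// mul1r; exact: max0.
pose w i := UnitBall (w1 i).
have := @red_comb w 0; rewrite red0 => /(_ _)/esym/free/(_ i0).
have -> : \row_i ball_val (w i) = (v 0 i0)^-1 *: v.
  by apply/rowP => i; rewrite !mxE.
have -> : comb ((v 0 i0)^-1 *: v) = 0.
  by rewrite linearZ /= (v0 : comb v = 0) scaler0.
(* Freeness makes the class of the [i0]-th coefficient vanish, yet that coefficient is 1. *)
move=> /(_ erefl); rewrite -(red0 k); apply/eq_red => /=.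
by rewrite mulVf// subr0 unorm11 ltxx.
Qed.

Hypothesis span : forall x : reduction A, exists c : 'I_n -> residue_field k,
  x = \sum_i c i *: red (f i).

(** One digit of the expansion: [vb.1] holds its coefficients, [vb.2] the remainder. The bound on
    [a] sits under the existential so that choice yields a function on all of [A], which can be
    iterated. *)
Lemma comb_approx (pi : k) :
  0 < unorm pi :> R -> (forall x : k, unorm x < 1 :> R -> unorm x <= unorm pi :> R) ->
  forall a : A, exists vb : 'rV[k]_n * A, unorm a <= 1 :> R ->
    [/\ forall i, unorm (vb.1 0 i) <= 1 :> R, unorm vb.2 <= 1 :> R &
        a = comb vb.1 + pi *: vb.2].
Proof.
move=> pi0 pimax a; have [a1|] := boolP (unorm a <= 1 :> R); last by exists (0, 0).
have [c cE] := span (red (UnitBall (a1 : closed_ball A a))).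
pose d i : unit_ball k := lift_red (c i).
pose v : 'rV[k]_n := \row_i ball_val (d i).
have pin0 : pi != 0 by rewrite -(unorm_gt0 pi).
exists (v, pi^-1 *: (a - comb v)) => _; split=> [i||] /=.
- by rewrite mxE; case: (d i).
- rewrite unormZ absV mulrC ler_pdivrMr// mul1r.
  (* [a - comb v] reduces to 0, so its norm is below 1; being a value of [k], it is then at most
     [unorm pi]. *)
  have [e ae] := unorm_in_value_group (a - comb v).
  rewrite ae; apply: pimax; rewrite -ae.
  pose s : unit_ball A := \sum_i ball_scale (d i) (f i).
  have sE : ball_val s = comb v.
    by rewrite val_ball_sum; apply: eq_bigr => i _; rewrite mxE.
  rewrite -sE; apply/(eq_red (UnitBall (a1 : closed_ball A a))).
  by rewrite cE (red_comb sE); apply: eq_bigr => i _; rewrite lift_redK.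
- by rewrite scalerA mulfV// scale1r addrC subrK.
Qed.

Lemma comb_surj_ball (a : A) : unorm a <= 1 :> R -> exists v, comb v = a.
Proof.
move=> a1; have [pi [pi0 pi1 pimax]] := uniformizer k.
have [g gP] := choice (comb_approx pi0 pimax).
(* [r m] is the remainder after [m] digits, and [s m] below collects the coefficients of these
   digits. *)
pose r m := iter m (fun b => (g b).2) a.
have r1 m : unorm (r m) <= 1 :> R by elim: m => //= m /gP[].
pose s m := \sum_(j < m) pi ^+ j *: (g (r j)).1.
have aE m : a = comb (s m) + pi ^+ m *: r m.
  elim: m => [|m IH].
    by rewrite /s big_ord0 linear0 add0r expr0 scale1r.
  rewrite /s big_ord_recr /= linearD linearZ /= -/(s m).
  rewrite {1}IH -addrA; congr (_ + _).
  have [_ _ {1}->] := gP _ (r1 m).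
  by rewrite scalerDr scalerA exprSr.
have absX m : unorm (pi ^+ m) = (unorm pi : R) ^+ m.
  by elim: m => [|m IH]; rewrite ?expr0 ?unorm11// !exprS absM IH.
have cau i : ucauchy (fun m => s m 0 i).
  apply: (@geometric_ucauchy _ _ _ (unorm pi : R)) => //; first exact: ltW.
  move=> m; rewrite /s big_ord_recr /= !mxE addrAC subrr add0r absM absX.
  by have [v1 _ _] := gP _ (r1 m); rewrite ler_piMr// exprn_ge0// ltW.
have [l lP] := choice (fun i => @abs_complete R k _ (cau i)).
(* If the limit combination missed [a], the error [y] would have positive norm, hence exceed some
   power of [unorm pi]. *)
exists (\row_i l i); apply/esym/eqP; rewrite -subr_eq0; apply/negPn/negP.
set y := a - _; rewrite -(unorm_gt0 y) => y0.
have [N yN] := expr_lt_eps (ltW pi0) pi1 y0.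
have [M MP] := choice (fun i => lP i _ (exprn_gt0 N pi0)).
(* Past [N] the remainder term is small; past every [M i] each coordinate is close to its limit. *)
pose m := maxn N (\max_i M i).
suff : unorm y <= (unorm pi : R) ^+ N by rewrite leNgt yN.
have -> : y = comb (s m - \row_i l i) + pi ^+ m *: r m.
  by rewrite linearB addrAC -aE.
rewrite (le_trans (unormD _ _))// ge_max; apply/andP; split.
  apply: unorm_sum_le => [|i]; first by rewrite exprn_ge0 ?ltW.
  rewrite unormZ (@le_trans _ _ (unorm ((s m - \row_i l i) 0 i)))//.
    by rewrite ler_piMr ?unorm_ge0//; case: (f i).
  rewrite !mxE ltW// MP// leq_max (leq_trans _ (leq_bigmax i)) ?orbT//.
rewrite unormZ absX (@le_trans _ _ ((unorm pi : R) ^+ m))//.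
  by rewrite ler_piMr// exprn_ge0// ltW.
by rewrite ler_wiXn2l ?leq_maxl// ltW.
Qed.

(** Dividing by a scalar of the same norm reduces to the unit ball. *)
Lemma comb_surj (a : A) : exists v, comb v = a.
Proof.
have [c ac] := unorm_in_value_group a.
have [->|a0] := eqVneq a 0.
  by exists 0; rewrite linear0.
have c0 : c != 0 by rewrite -(unorm_gt0 c) -ac (unorm_gt0 a).
have [|v vE] := @comb_surj_ball (c^-1 *: a).
  by rewrite unormZ ac absV mulVf// gt_eqF// (unorm_gt0 c).
by exists (c *: v); rewrite linearZ /= vE scalerA mulfV// scale1r.
Qed.

End Lift.

End Banach.

(** * Finite dimension and simplicity *)

Theorem theorem3p3 (R : realType) (k : localFieldType R) (A : banachAlgType k)
  (hval : range (@unorm R A) = range (@unorm R k))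
  (hred : fin_dim_simple_algebra (reduction A : algType (residue_field k))) :
  fin_dim_simple_algebra (A : algType k).
Proof.
case: hred => /finite_dimensional_basis[n [e [free span]]] simp.
split.
  pose f i := lift_red (e i).
  have fE i : red (f i) = e i by exact: lift_redK.
  have surj : forall a, exists v, comb f v = a.
    apply: (comb_surj hval) => x; have [c ->] := span x.
    by exists c; apply: eq_bigr => i _; rewrite fE.
  have inj : injective (comb f).
    apply: comb_free => c; under eq_bigr do rewrite fE; exact: free.
  have [g gK] := choice surj; have Kg : cancel (comb f) g by move=> v; apply: inj.
  exists n; constructor; exists g; last by exists (comb f).
  by move=> c x y; apply: inj; rewrite linearP /= !gK.
move=> I [I0 ID IMl IMr].
have [[x [Ix x0]]|] := pselect (exists x, I x /\ x <> 0); last first.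
  move=> /forallNP I00; left; apply/seteqP; split=> [x Ix|x ->//] /=.
  by apply: contrapT => x0; apply: (I00 x).
(* A ring ideal is stable under scalars because [c *: a = (c *: 1) * a]. *)
right; have IZ c a : I a -> I (c *: a).
  by move=> Ia; rewrite -[a]mul1r scalerAl; exact: IMl.
(* [J] is the reduction of the part of [I] in the unit ball. *)
pose J : set (reduction A) := [set y | exists a, I (ball_val a) /\ red a = y].
have idealJ : two_sided_ideal J.
  split.
  - by exists 0; rewrite red0.
  - move=> _ _ [a [Ia <-]] [b [Ib <-]]; exists (a + b); rewrite redD.
    by split=> //; exact: ID.
  - move=> b _ [a [Ia <-]]; exists (lift_red b * a); rewrite redM lift_redK.
    by split=> //; exact: IMl.
  - move=> b _ [a [Ia <-]]; exists (a * lift_red b); rewrite redM lift_redK.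
    by split=> //; exact: IMr.
(* Scaling [x] to norm 1 gives an element of [I] with nonzero class, so [J] is not zero. *)
have [c xc] := unorm_in_value_group hval x.
have c0 : 0 < unorm c :> R by rewrite -xc unorm_gt0; apply/eqP.
have y1 : unorm (c^-1 *: x) = 1 :> R by rewrite unormZ absV xc mulVf// gt_eqF.
have y1' : closed_ball A (c^-1 *: x) by rewrite /closed_ball y1.
have JT : J = [set: reduction A].
  case: (simp J idealJ) => // J0.
  have : J (red (UnitBall y1')) by exists (UnitBall y1'); split=> //; exact: IZ.
  rewrite J0 /= -(red0 A) => /eq_red /=.
  by rewrite subr0 y1 ltxx.
have Je i : exists a, I (ball_val a) /\ red a = e i.
  by have : J (e i) by rewrite JT.
(* The [e i] are lifted afresh, now inside [I]. *)
have [f fP] := choice Je.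
apply/seteqP; split=> // a _.
have [|v <-] := @comb_surj _ _ _ hval _ f _ a.
  move=> z; have [d ->] := span z; exists d.
  by apply: eq_bigr => i _; have [_ ->] := fP i.
by rewrite /comb; elim/big_ind: _ => // i _; apply: IZ; have [] := fP i.
Qed.
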